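(* (Gluing Principle) In $\mathbf{Spaces}$, let $1_L,1_R\colon \{1\}\to (0,1]\amalg[1,\infty)$ be the global points $1$ in the left and in the right component of the coproduct respectively, and let $P\colon (0,1]\amalg[1,\infty)\to(0,\infty)$ be the copairing of the two natural inclusions. Then the diagram $$\{1\}\ \rightrightarrows\ (0,1]\amalg[1,\infty)\ \xrightarrow{\;P\;}\ (0,\infty),$$ in which the parallel pair is $(1_L,1_R)$, is a coequaliser, and it is stable under pullbacks.
   Context: All spaces are point-free. $\mathbf{Spaces}$ is the opposite of the category of frames and frame homomorphisms; its objects are (localic) spaces, and its morphisms are maps. A space is presented by a propositional geometric theory, whose models are its points. $\{1\}$ is the one-point space. $\mathbb{R}$ is the space of Dedekind reals: a point $x$ is a pair $(L_x,R_x)$ of subsets of $\mathbb{Q}$ (write $q<x$ for $q\in L_x$ and $x<r$ for $r\in R_x$) such that both are inhabited; $q\in L_x$ iff there is $q'>q$ with $q'\in L_x$; $r\in R_x$ iff there is $r'<r$ with $r'\in R_x$; $q\in L_x$ and $r\in R_x$ imply $q<r$; and $q<r$ implies $q\in L_x$ or $r\in R_x$. Subspaces are given by adding axioms: $(0,\infty)$ is the open subspace given by $0<x$; $(0,1]$ is the subspace of $(0,\infty)$ that is the closed complement of $(1,\infty)$ (axiom: $1<x\Rightarrow\bot$); $[1,\infty)$ is the closed complement of $(-\infty,1)$ (axiom: $x<1\Rightarrow\bot$). A coequaliser diagram over $(0,\infty)$ is stable under pullbacks if, for every map $Z\to(0,\infty)$, the diagram obtained by pulling back along it is again a coequaliser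 diagram. *)

(* Defs.v *)
From Stdlib Require Import List.
From mathcomp Require Import all_boot all_order all_algebra.
From mathcomp Require Import boolp classical_sets.

Set Implicit Arguments.
Unset Strict Implicit.
Unset Printing Implicit Defensive.

Import Order.TTheory GRing.Theory Num.Theory.
Local Open Scope ring_scope.
Local Open Scope classical_set_scope.

(* Frames are ordered by a Prop-valued relation and joins range over all
   subsets, so no decidability is built in.  Leibniz equality of opens and of
   maps is the intended one, by the extensionality principles of boolp. *)
Record frame : Type := Frame {
  opens :> Type;
  ople : opens -> opens -> Prop;
  optop : opens;
  opmeet : opens -> opens -> opens;
  opjoin : set opens -> opens;
  ople_refl : forall a, ople a a;
  ople_trans : forall a b c, ople a b -> ople b c -> ople a c;
  ople_anti : forall a b, ople a b -> ople b a -> a = b;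
  ople_top : forall a, ople a optop;
  ople_meet : forall a b c, ople c (opmeet a b) <-> ople c a /\ ople c b;
  opjoin_le : forall S c, ople (opjoin S) c <-> forall a, S a -> ople a c;
  opmeet_join : forall a S,
    ople (opmeet a (opjoin S)) (opjoin [set opmeet a b | b in S])
}.

Record frame_hom (A B : frame) : Type := FrameHom {
  fhom :> A -> B;
  fhom_top : fhom (optop A) = optop B;
  fhom_meet : forall a b, fhom (opmeet a b) = opmeet (fhom a) (fhom b);
  fhom_join : forall S, fhom (opjoin S) = opjoin (fhom @` S)
}.

Lemma frame_homP (A B : frame) (f g : frame_hom A B) : f =1 g -> f = g.
Proof.
case: f => f ft fm fj; case: g => g gt gm gj /= /funext fg.
by subst g; congr FrameHom; exact: Prop_irrelevance.
Qed.

Definition hom_id (A : frame) : frame_hom A A.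
Proof.
refine (@FrameHom A A (fun a => a) erefl (fun _ _ => erefl) _).
by move=> S; rewrite image_id.
Defined.

Definition hom_comp (A B C : frame) (g : frame_hom B C) (f : frame_hom A B) :
  frame_hom A C.
Proof.
refine (@FrameHom A C (fun a => g (f a)) _ _ _).
- by rewrite !fhom_top.
- by move=> a b; rewrite !fhom_meet.
- by move=> S; rewrite !fhom_join image_comp.
Defined.

(* The category Spaces is the opposite of the category of frames. *)
Definition space : Type := frame.
Definition smap (X Y : space) : Type := frame_hom Y X.
Definition sid (X : space) : smap X X := hom_id X.
Definition scomp (X Y Z : space) (g : smap Y Z) (f : smap X Y) : smap X Z :=
  hom_comp f g.

Notation "X ~> Y" := (smap X Y) (at level 99, Y at level 200).
Notation "g \oS f" := (scomp g f) (at level 50, left associativity).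

Definition is_coequaliser (X Y Q : space) (u v : X ~> Y) (p : Y ~> Q) : Prop :=
  p \oS u = p \oS v /\
  forall (W : space) (h : Y ~> W), h \oS u = h \oS v ->
    exists! k : Q ~> W, k \oS p = h.

Definition is_pullback (W X Y Z : space)
    (p : W ~> X) (q : W ~> Y) (f : X ~> Z) (g : Y ~> Z) : Prop :=
  f \oS p = g \oS q /\
  forall (T : space) (x : T ~> X) (y : T ~> Y), f \oS x = g \oS y ->
    exists! t : T ~> W, p \oS t = x /\ q \oS t = y.

(* The fork u, v : X => Y -> Q lives over Q, X through p \oS u = p \oS v.  For
   f : Z ~> Q, its pullback along f is u', v' : X' => Y' -> Z, where X' and Y'
   are the pullbacks of X and Y along f, and u', v' are the maps over Z
   induced by u and v. *)
Definition pullback_stable_coequaliser (X Y Q : space)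
    (u v : X ~> Y) (p : Y ~> Q) : Prop :=
  forall (Z : space) (f : Z ~> Q)
    (X' Y' : space)
    (xX : X' ~> X) (xZ : X' ~> Z) (yY : Y' ~> Y) (yZ : Y' ~> Z)
    (u' v' : X' ~> Y'),
    is_pullback xX xZ (p \oS u) f ->
    is_pullback yY yZ p f ->
    yY \oS u' = u \oS xX -> yZ \oS u' = xZ ->
    yY \oS v' = v \oS xX -> yZ \oS v' = xZ ->
    is_coequaliser u' v' yZ.

Definition one_space : space.
Proof.
refine (@Frame Prop (fun P Q => P -> Q) True and
  (fun S => exists2 P, S P & P) _ _ _ _ _ _ _).
- by [].
- by move=> P Q R PQ QR /PQ.
- by move=> P Q PQ QP; apply: propext.
- by [].
- move=> P Q R; split=> [h|[h k] r]; last by split; [exact: h|exact: k].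
  by split=> /h [].
- move=> S c; split=> [h P SP p|h [P SP p]]; last exact: h SP p.
  by apply: h; exists P.
- by move=> P S [p [Q SQ q]]; exists (P /\ Q) => //; exists Q.
Defined.

(* The frame of a coproduct of spaces is the product of the frames. *)
Definition coprod (X Y : space) : space.
Proof.
refine (@Frame (X * Y)%type
  (fun a b => ople a.1 b.1 /\ ople a.2 b.2)
  (optop X, optop Y)
  (fun a b => (opmeet a.1 b.1, opmeet a.2 b.2))
  (fun S => (opjoin (fst @` S), opjoin (snd @` S))) _ _ _ _ _ _ _).
- by move=> a; split; exact: ople_refl.
- by move=> a b c [h1 h2] [k1 k2]; split; apply: ople_trans; eassumption.
- by move=> [a1 a2] [b1 b2] [/= h1 h2] [/= k1 k2]; congr pair; exact: ople_anti.
- by move=> a; split; exact: ople_top.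
- move=> a b c /=; rewrite !ople_meet; tauto.
- move=> S c /=; rewrite !opjoin_le; split.
    by move=> [h k] a Sa; split; [apply: h|apply: k]; exists a.
  by move=> h; split=> _ [a /h [h1 h2] <-].
- move=> a S /=; split; (apply: ople_trans; first exact: opmeet_join);
    apply/opjoin_le => _ [_ [b Sb <-] <-]; apply: (iffLR (opjoin_le _ _));
    try exact: ople_refl.
  all: by exists (opmeet a.1 b.1, opmeet a.2 b.2) => //; exists b.
Defined.

Definition coprod_inl (X Y : space) : X ~> coprod X Y :=
  @FrameHom (coprod X Y) X fst erefl (fun _ _ => erefl) (fun _ => erefl).

Definition coprod_inr (X Y : space) : Y ~> coprod X Y :=
  @FrameHom (coprod X Y) Y snd erefl (fun _ _ => erefl) (fun _ => erefl).

Definition copair (X Y Z : space) (f : X ~> Z) (g : Y ~> Z) : coprod X Y ~> Z.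
Proof.
refine (@FrameHom Z (coprod X Y) (fun a => (f a, g a)) _ _ _).
- by rewrite !fhom_top.
- by move=> a b; rewrite !fhom_meet.
- by move=> S; rewrite !fhom_join /= !image_comp.
Defined.

Lemma copairP (X Y Z : space) (f : X ~> Z) (g : Y ~> Z) (h : coprod X Y ~> Z) :
  h = copair f g <-> h \oS coprod_inl X Y = f /\ h \oS coprod_inr X Y = g.
Proof.
split=> [->|[<- <-]]; first by split; exact: frame_homP.
by apply: frame_homP => a /=; case: (fhom h a).
Qed.

(* A finite conjunction of propositional symbols is a list, a geometric
   formula is a set of such lists (their disjunction), and [thaxiom l S]
   asserts the sequent /\ l |- \/_(k in S) /\ k.  By distributivity every
   geometric axiom is equivalent to a set of sequents of this form. *)
Record theory : Type := Theory {
  thsym : Type;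
  thaxiom : seq thsym -> set (seq thsym) -> Prop
}.

Definition add_axiom (T : theory) (l : seq (thsym T)) (S : set (seq (thsym T))) :
  theory :=
  @Theory (thsym T) (fun l' S' => thaxiom l' S' \/ (l' = l /\ S' = S)).

Definition fconj (X : frame) (G : Type) (m : G -> X) (l : seq G) : X :=
  foldr (fun g a => opmeet (m g) a) (optop X) l.

(* A model of T in X is a generalised point of the space of T at stage X. *)
Definition is_model (T : theory) (X : frame) (m : thsym T -> X) : Prop :=
  forall l S, thaxiom l S -> ople (fconj m l) (opjoin [set fconj m k | k in S]).

Section Presentation.
Variable T : theory.
Notation G := (thsym T).
Implicit Types (k l : seq G) (U V : set (seq G)).

(* The frame presented by T: sets of finite conjunctions, closed under
   strengthening a conjunction and, in any context k, under the axioms. *)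
Definition saturated U : Prop :=
  (forall l k, U l -> incl l k -> U k) /\
  (forall l S k, thaxiom l S -> (forall s, S s -> U (s ++ k)) -> U (l ++ k)).

Definition saturation U : set (seq G) :=
  [set l | forall V, saturated V -> U `<=` V -> V l].

Lemma saturation_sat U : saturated (saturation U).
Proof.
split=> [l k Ul lk V sV UV|l S k ax h V sV UV].
  by apply: (sV.1 l) => //; exact: Ul.
by apply: (sV.2 l S) => // s Ss; exact: h.
Qed.

Lemma saturation_sub U : U `<=` saturation U.
Proof. by move=> l Ul V _; exact. Qed.

Definition sat_set : Type := {U : set (seq G) | saturated U}.

Lemma sat_set_eq (A B : sat_set) : sval A `<=` sval B -> sval B `<=` sval A -> A = B.
Proof.
case: A B => [A sA] [B sB] /= AB BA.
have E : A = B by apply/seteqP.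
by subst B; congr exist; exact: Prop_irrelevance.
Qed.

Lemma saturatedT : saturated setT.
Proof. by []. Qed.

Lemma saturatedI U V : saturated U -> saturated V -> saturated (U `&` V).
Proof.
move=> sU sV; split=> [l k [Ul Vl] lk|l S k ax h].
  by split; [apply: (sU.1 l)|apply: (sV.1 l)].
by split; [apply: (sU.2 l S)|apply: (sV.2 l S)] => // s /h [].
Qed.

Definition sat_join (F : set sat_set) : sat_set :=
  exist _ _ (saturation_sat [set l | exists2 A, F A & sval A l]).

Lemma sat_distr U V F :
  saturated U -> saturated V ->
  (forall A, F A -> U `&` sval A `<=` V) -> U `&` sval (sat_join F) `<=` V.
Proof.
move=> sU sV UFV k [Uk].
move=> /(_ [set l | forall j, U j -> V (l ++ j)]) /= h.
have : forall j, U j -> V (k ++ j).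
  apply: h => [|l [A FA Al] j Uj].
    split=> [l k' h lk' j /h|l S k' ax h j Uj].
      by move=> /sV.1; apply; apply: incl_app; [exact: incl_appl|exact: incl_appr (incl_refl _)].
    by rewrite -catA; apply: (sV.2 l S) => // s /h /(_ j Uj); rewrite catA.
  apply: (UFV A) => //; split.
    by apply: sU.1 Uj _; exact: incl_appr (incl_refl _).
  by apply: (svalP A).1 Al _; exact: incl_appl (incl_refl _).
by move=> /(_ k Uk) /sV.1; apply; apply: incl_app; exact: incl_refl.
Qed.

Definition space_of : space.
Proof.
refine (@Frame sat_set (fun A B => sval A `<=` sval B)
  (exist _ _ saturatedT)
  (fun A B => exist _ _ (saturatedI (svalP A) (svalP B)))
  sat_join _ _ _ _ _ _ _).
- by move=> A l.
- by move=> A B C; exact: subset_trans.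
- exact: sat_set_eq.
- by move=> A l.
- by move=> A B C /=; rewrite subsetI.
- move=> F C; split=> [h A FA l Al|h l]; last first.
    by apply; [exact: svalP|move=> k [A FA]; exact: h].
  by apply: h; apply: saturation_sub; exists A.
- move=> A F /=; apply: sat_distr; [exact: svalP|exact: saturation_sat|].
  move=> B FB l ABl; apply: saturation_sub.
  by exists (exist _ _ (saturatedI (svalP A) (svalP B))) => //; exists B.
Defined.

Definition sat_of k : space_of := exist _ _ (saturation_sat [set k]).
Definition generic (g : G) : space_of := sat_of [:: g].

Lemma sat_of_min k (A : space_of) : sval A k <-> ople (sat_of k) A.
Proof.
split=> [Ak l|]; last by apply; exact: saturation_sub.
by apply; [exact: svalP|move=> _ ->].
Qed.

Lemma conj_generic k : fconj generic k = sat_of k.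
Proof.
elim: k => [|g k IH].
  apply: sat_set_eq => [l _|//].
  exact: (saturation_sat _).1 (saturation_sub erefl) (@incl_nil_l _ _).
rewrite [LHS](_ : _ = opmeet (generic g) (sat_of k)); last by rewrite -IH.
apply: (@ople_anti space_of); last first.
  apply/ople_meet; split; apply/sat_of_min.
    by apply: (saturation_sat _).1 (saturation_sub erefl) _ => x [<-|[]]; left.
  by apply: (saturation_sat _).1 (saturation_sub erefl) _ => x; right.
have Hg : forall l, sval (generic g) l -> sval (sat_of (g :: k)) (l ++ k).
  move=> l /(_ [set l | sval (sat_of (g :: k)) (l ++ k)]); apply; last first.
    by move=> _ ->; exact: saturation_sub.
  split=> [l1 l2 h i|l1 S j ax h].
    by apply: (saturation_sat _).1 h _; apply: incl_app; [exact: incl_appl|exact: incl_appr (incl_refl _)].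
  by rewrite /mkset -catA; apply: (saturation_sat _).2 ax _ => s /h; rewrite catA.
move=> l [/Hg gl].
move=> /(_ [set j | sval (sat_of (g :: k)) (l ++ j)]) h.
have : sval (sat_of (g :: k)) (l ++ l).
  apply: h => [|_ -> //]; split=> [l1 l2 h i|l1 S j ax h].
    by apply: (saturation_sat _).1 h _; apply: incl_app; [exact: incl_appl (incl_refl _)|exact: incl_appr].
  have sw s : incl (s ++ (l ++ j)) (l ++ (s ++ j)) /\ incl (l ++ (s ++ j)) (s ++ (l ++ j)).
    by split=> x; rewrite !in_app_iff; tauto.
  apply: (saturation_sat _).1 (sw l1).1; apply: (saturation_sat _).2 ax _ => s /h hs.
  by apply: (saturation_sat _).1 hs (sw s).2.
by move=> /(saturation_sat _).1; apply; apply: incl_app; exact: incl_refl.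
Qed.

Lemma generic_model : is_model generic.
Proof.
move=> l S ax; rewrite conj_generic; apply/sat_of_min.
rewrite -[l]cats0; apply: (saturation_sat _).2 ax _ => s Ss.
rewrite cats0; apply: saturation_sub; exists (sat_of s); first by exists s => //; exact: conj_generic.
exact: saturation_sub.
Qed.

End Presentation.

Section FrameFacts.
Variable X : frame.
Implicit Types (a b c : X) (S : set X).

Lemma meet_le1 a b : ople (opmeet a b) a.
Proof. by have [] := (ople_meet a b (opmeet a b)).1 (ople_refl _). Qed.

Lemma meet_le2 a b : ople (opmeet a b) b.
Proof. by have [] := (ople_meet a b (opmeet a b)).1 (ople_refl _). Qed.

Lemma le_meetC a b : ople (opmeet a b) (opmeet b a).
Proof. by apply/ople_meet; split; [exact: meet_le2|exact: meet_le1]. Qed.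

Lemma le_join S a : S a -> ople a (opjoin S).
Proof. exact: (opjoin_le S (opjoin S)).1 (ople_refl _) a. Qed.

Lemma join_mono S S' :
  (forall a, S a -> exists2 b, S' b & ople a b) -> ople (opjoin S) (opjoin S').
Proof.
by move=> h; apply/opjoin_le => a /h [b S'b ab]; apply: ople_trans ab (le_join S'b).
Qed.

Lemma conj_le (G : Type) (m : G -> X) l g : List.In g l -> ople (fconj m l) (m g).
Proof.
elim: l => //= h l IH [->|/IH]; first exact: meet_le1.
exact: ople_trans (meet_le2 _ _).
Qed.

Lemma le_conj (G : Type) (m : G -> X) l a :
  (forall g, List.In g l -> ople a (m g)) -> ople a (fconj m l).
Proof.
elim: l => [|h l IH] hl /=; first exact: ople_top.
by apply/ople_meet; split; [apply: hl; left|apply: IH => g gl; apply: hl; right].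
Qed.

Lemma conj_incl (G : Type) (m : G -> X) k l : incl k l -> ople (fconj m l) (fconj m k).
Proof. by move=> kl; apply: le_conj => g /kl; exact: conj_le. Qed.

Lemma conj_cat (G : Type) (m : G -> X) k l :
  fconj m (k ++ l) = opmeet (fconj m k) (fconj m l).
Proof.
apply: ople_anti.
  by apply/ople_meet; split; apply: conj_incl; [exact: incl_appl (incl_refl _)|exact: incl_appr (incl_refl _)].
apply: le_conj => g /in_app_iff [] /(conj_le m) h.
  by apply: ople_trans (meet_le1 _ _) h.
by apply: ople_trans (meet_le2 _ _) h.
Qed.

Lemma model_saturated (T : theory) (m : thsym T -> X) c :
  is_model m -> saturated [set l | ople (fconj m l) c].
Proof.
move=> mm; split=> [l k lc lk|l S k /mm ax h] /=; first exact: ople_trans (conj_incl m lk) lc.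
rewrite conj_cat.
apply: (@ople_trans _ _ (opmeet (fconj m k) (opjoin [set fconj m s | s in S]))).
  apply/ople_meet; split; first exact: meet_le2.
  exact: ople_trans (meet_le1 _ _) ax.
apply: ople_trans (opmeet_join _ _) _.
apply/opjoin_le => _ [_ [s Ss <-] <-]; apply: ople_trans (le_meetC _ _) _.
by rewrite -conj_cat; exact: h.
Qed.

End FrameFacts.

Definition classify (T : theory) (X : space) (m : thsym T -> X) (mm : is_model m) :
  X ~> space_of T.
Proof.
refine (@FrameHom (space_of T) X (fun A => opjoin [set fconj m l | l in sval A]) _ _ _).
- apply: ople_anti; first exact: ople_top.
  by apply: le_join; exists [::].
- move=> A B; apply: ople_anti.
    by apply/ople_meet; split; apply: join_mono => _ [l [Al Bl] <-];
      exists (fconj m l); try exact: ople_refl; exists l.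
  apply: ople_trans (opmeet_join _ _) _.
  apply/opjoin_le => _ [_ [l Bl <-] <-].
  apply: ople_trans (le_meetC _ _) _; apply: ople_trans (opmeet_join _ _) _.
  apply/opjoin_le => _ [_ [k Ak <-] <-].
  rewrite -conj_cat; apply: le_join; exists (l ++ k) => //; split.
    by apply: (svalP A).1 Ak _; exact: incl_appr (incl_refl _).
  by apply: (svalP B).1 Bl _; exact: incl_appl (incl_refl _).
- move=> F; apply: ople_anti; last first.
    apply/opjoin_le => _ [A FA <-]; apply: join_mono => _ [l Al <-].
    exists (fconj m l); last exact: ople_refl.
    by exists l => //; apply: saturation_sub; exists A.
  apply/opjoin_le => _ [l Fl <-].
  apply: (Fl _ (model_saturated _ mm)) => k [A FA Ak] /=.
  apply: ople_trans (le_join _); last by exists A.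
  by apply: le_join; exists k.
Defined.

(* Universal property: maps into space_of T are the models of T. *)
Lemma classify_generic (T : theory) (X : space) (m : thsym T -> X)
    (mm : is_model m) g : classify mm (generic g) = m g.
Proof.
have conj1 : ople (m g) (fconj m [:: g]) by apply: le_conj => _ [<-|[]]; exact: ople_refl.
apply: ople_anti; last first.
  by apply: ople_trans conj1 (le_join _); exists [:: g] => //; exact: saturation_sub.
apply/opjoin_le => _ [l gl <-].
by apply: (gl _ (model_saturated _ mm)) => _ ->; apply: conj_le; left.
Qed.

Lemma hom_conj (X Y : frame) (f : frame_hom X Y) (G : Type) (m : G -> X) l :
  f (fconj m l) = fconj (fun g => f (m g)) l.
Proof. by elim: l => [|g l /= <-]; rewrite /= ?fhom_top ?fhom_meet. Qed.

Lemma classify_unique (T : theory) (X : space) (f g : X ~> space_of T) :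
  (forall s, f (generic s) = g (generic s)) -> f = g.
Proof.
move=> fg; apply: frame_homP => A.
have -> : A = opjoin [set fconj (@generic T) l | l in sval A].
  apply: (@ople_anti (space_of T)).
    move=> l Al; apply: saturation_sub; exists (sat_of l); last exact: saturation_sub.
    by exists l => //; exact: conj_generic.
  by apply/opjoin_le => _ [l Al <-]; rewrite conj_generic; apply/sat_of_min.
rewrite !fhom_join !image_comp; congr opjoin; apply: eq_imagel => l _ /=.
by rewrite !hom_conj; congr fconj; exact: funext.
Qed.

Lemma add_axiom_model (T : theory) l S : 
  @is_model T (space_of (@add_axiom T l S)) (@generic (@add_axiom T l S)).
Proof. by move=> k R ax; apply: (@generic_model (@add_axiom T l S)); left. Qed.

(* Pullbacks exist, so [pullback_stable_coequaliser] is not vacuous. *)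

Section Pullback.
Variables (X Y Z : space) (f : X ~> Z) (g : Y ~> Z).

Definition hom_axioms (A : frame) (G : Type) (i : A -> G) l S : Prop :=
  [\/ l = [::] /\ S = [set [:: i (optop A)]],
      exists a b, l = [:: i a; i b] /\ S = [set [:: i (opmeet a b)]],
      exists2 p : A * A, ople p.1 p.2 & l = [:: i p.1] /\ S = [set [:: i p.2]] |
      exists F, l = [:: i (opjoin F)] /\ S = [set [:: i a] | a in F]].

Definition pullback_theory : theory :=
  @Theory (X + Y)%type (fun l S =>
    [\/ hom_axioms inl l S, hom_axioms inr l S,
        exists c, l = [:: inl (f c)] /\ S = [set [:: inr (g c)]] |
        exists c, l = [:: inr (g c)] /\ S = [set [:: inl (f c)]]]).

Lemma conj1 (A : frame) (G : Type) (m : G -> A) s : fconj m [:: s] = m s.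
Proof.
apply: ople_anti; first exact: meet_le1.
by apply/ople_meet; split; [exact: ople_refl|exact: ople_top].
Qed.

Lemma join_set1 (A : frame) (a : A) : opjoin [set a] = a.
Proof.
apply: ople_anti; last exact: le_join.
by apply/opjoin_le => _ ->; exact: ople_refl.
Qed.

Lemma seq1_join (A : frame) (G : Type) (m : G -> A) s :
  opjoin [set fconj m k | k in [set [:: s]]] = m s.
Proof. by rewrite image_set1 join_set1 conj1. Qed.

Lemma hom_mono (A B : frame) (h : frame_hom A B) a b :
  ople a b -> ople (h a) (h b).
Proof.
move=> ab; have -> : a = opmeet a b.
  apply: ople_anti; last exact: meet_le1.
  by apply/ople_meet; split=> //; exact: ople_refl.
by rewrite fhom_meet; exact: meet_le2.
Qed.

Section HomOfAxioms.
Variables (A B : frame) (G : Type) (i : A -> G) (m : G -> B).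
Hypothesis mm : forall l S, hom_axioms i l S ->
  ople (fconj m l) (opjoin [set fconj m k | k in S]).

Let mono a b : ople a b -> ople (m (i a)) (m (i b)).
Proof.
move=> ab; rewrite -(conj1 m (i a)) -(seq1_join m (i b)); apply: mm.
by apply: Or43; exists (a, b).
Qed.

Definition hom_of_axioms : frame_hom A B.
Proof.
refine (@FrameHom A B (fun a => m (i a)) _ _ _).
- apply: ople_anti; first exact: ople_top.
  by rewrite -(seq1_join m); apply: (@mm [::]); apply: Or41.
- move=> a b; apply: ople_anti.
    by apply/ople_meet; split; apply: mono; [exact: meet_le1|exact: meet_le2].
  rewrite -(seq1_join m (i (opmeet a b))) -(conj1 m (i b)).
  by apply: (@mm [:: i a; i b]); apply: Or42; exists a, b.
- move=> F; apply: ople_anti; last first.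
    by apply/opjoin_le => _ [a Fa <-]; apply: mono; exact: le_join.
  rewrite -(conj1 m (i (opjoin F))); apply: ople_trans (mm _) _; first by apply: Or44; exists F.
  apply/opjoin_le => _ [_ [a Fa <-] <-]; rewrite conj1.
  by apply: le_join; exists a.
Defined.

End HomOfAxioms.

Lemma hom_axioms_hom (A B : frame) (h : frame_hom A B) (G : Type) (i : A -> G)
    (m : G -> B) : (forall a, m (i a) = h a) ->
  forall l S, hom_axioms i l S ->
    ople (fconj m l) (opjoin [set fconj m k | k in S]).
Proof.
move=> mh l S [[-> ->]|[a [b [-> ->]]]|[p ab [-> ->]]|[F [-> ->]]].
- by rewrite seq1_join mh fhom_top; exact: ople_top.
- rewrite seq1_join mh fhom_meet /= !mh; apply/ople_meet; split; first exact: meet_le1.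
  exact: ople_trans (meet_le2 _ _) (meet_le1 _ _).
- by rewrite seq1_join conj1 !mh; exact: hom_mono.
- rewrite conj1 mh fhom_join image_comp; apply: join_mono => _ [a Fa <-].
  exists (h a); last exact: ople_refl.
  by exists a => //=; rewrite -mh -[RHS](conj1 m).
Qed.

Let gm := @generic_model pullback_theory.

Definition pullback_fst : space_of pullback_theory ~> X :=
  @hom_of_axioms X (space_of pullback_theory) _ inl _ (fun l S ax => gm (Or41 _ _ _ ax)).

Definition pullback_snd : space_of pullback_theory ~> Y :=
  @hom_of_axioms Y (space_of pullback_theory) _ inr _ (fun l S ax => gm (Or42 _ _ _ ax)).

Lemma pullbackP : is_pullback pullback_fst pullback_snd f g.
Proof.
split.
  have step a b : @thaxiom pullback_theory [:: a] [set [:: b]] ->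
      ople (@generic pullback_theory a) (@generic pullback_theory b).
    by move/gm; rewrite conj1 seq1_join.
  apply: frame_homP => c; apply: (@ople_anti (space_of pullback_theory)).
    by refine (step (inl (f c)) (inr (g c)) (Or43 _ _ _ (ex_intro _ c (conj erefl erefl)))).
  by refine (step (inr (g c)) (inl (f c)) (Or44 _ _ _ (ex_intro _ c (conj erefl erefl)))).
move=> T x y xy.
have fg c : x (f c) = y (g c) by exact: (congr1 (fun h : T ~> Z => h c) xy).
pose m (s : X + Y) : T := match s with inl a => x a | inr b => y b end.
have mm : @is_model pullback_theory T m.
  move=> l S [||[c [-> ->]]|[c [-> ->]]].
  - exact: (@hom_axioms_hom _ _ x).
  - exact: (@hom_axioms_hom _ _ y).
  - by rewrite conj1 seq1_join /= fg; exact: ople_refl.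
  - by rewrite conj1 seq1_join /= fg; exact: ople_refl.
exists (classify mm); split.
  by split; apply: frame_homP => a; exact: (classify_generic mm).
move=> t [tx ty]; apply: (@classify_unique pullback_theory) => -[a|b].
  by rewrite classify_generic /= -tx.
by rewrite classify_generic /= -ty.
Qed.

End Pullback.

Inductive cut_sym : Type :=
| Lo of rat   (* Lo q stands for q < x *)
| Up of rat.  (* Up r stands for x < r *)

Inductive cut_axiom : seq cut_sym -> set (seq cut_sym) -> Prop :=
| Lo_inhabited : cut_axiom [::] [set [:: Lo q] | q in setT]
| Up_inhabited : cut_axiom [::] [set [:: Up r] | r in setT]
| Lo_down (q q' : rat) : q < q' -> cut_axiom [:: Lo q'] [set [:: Lo q]]
| Lo_round (q : rat) : cut_axiom [:: Lo q] [set [:: Lo q'] | q' in [set q' | q < q']]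
| Up_up (r r' : rat) : r' < r -> cut_axiom [:: Up r'] [set [:: Up r]]
| Up_round (r : rat) : cut_axiom [:: Up r] [set [:: Up r'] | r' in [set r' | r' < r]]
  (* the right-hand side is the truth value q < r *)
| Cut_disjoint (q r : rat) : cut_axiom [:: Lo q; Up r] [set k | k = [::] /\ q < r]
| Cut_located (q r : rat) : q < r -> cut_axiom [::] [set [:: Lo q]; [:: Up r]].

Definition real_theory : theory := Theory cut_axiom.

(* (0,oo): the axiom 0 < x *)
Definition pos_theory : theory :=
  @add_axiom real_theory [::] [set [:: Lo 0]].

(* (0,1]: within (0,oo), the axiom 1 < x |- false *)
Definition pos_le1_theory : theory :=
  @add_axiom pos_theory [:: Lo 1] set0.

(* [1,oo): within the reals, the axiom x < 1 |- false *)
Definition ge1_theory : theory :=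
  @add_axiom real_theory [:: Up 1] set0.

Definition pos_reals : space := space_of pos_theory.
Definition pos_le1 : space := space_of pos_le1_theory.
Definition ge1 : space := space_of ge1_theory.

Definition incl_pos_le1 : pos_le1 ~> pos_reals :=
  classify (@add_axiom_model pos_theory [:: Lo 1] set0).

Lemma ge1_pos_model : @is_model pos_theory ge1 (@generic ge1_theory).
Proof.
move=> l S [ax|[-> ->]]; first exact: add_axiom_model.
have m := @generic_model ge1_theory.
apply: ople_trans (m _ _ (or_introl (@Cut_located 0 1 ltr01))) _.
apply/opjoin_le => _ [_ [->|->] <-]; first by apply: le_join; exists [:: Lo 0].
apply: ople_trans (m _ _ (or_intror (conj erefl erefl))) _.
by apply/opjoin_le => _ [? []].
Qed.

Definition incl_ge1 : ge1 ~> pos_reals := classify ge1_pos_model.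

(* Models of the theory at the one-point space are Dedekind sections. *)
Lemma real_modelP (m : cut_sym -> Prop) :
  let L q := m (Lo q) in let R r := m (Up r) in
  @is_model real_theory one_space m <->
  [/\ (exists q, L q) /\ (exists r, R r),
      forall q, L q <-> exists2 q', q < q' & L q',
      forall r, R r <-> exists2 r', r' < r & R r',
      forall q r, L q -> R r -> q < r &
      forall q r, q < r -> L q \/ R r].
Proof.
move=> L R; split=> [mm|[[[q0 Lq0] [r0 Rr0]] Lr Rr dis loc]].
  split.
  - split.
      by have [//|_ [_ [q _ <-] <-] [Lq _]] := mm _ _ Lo_inhabited; exists q.
    by have [//|_ [_ [r _ <-] <-] [Rr _]] := mm _ _ Up_inhabited; exists r.
  - move=> q; split=> [Lq|[q' qq' Lq']].
      by have [//|_ [_ [q' qq' <-] <-] [Lq' _]] := mm _ _ (Lo_round q); exists q'.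
    by have [//|_ [_ -> <-] [Lq _]] := mm _ _ (Lo_down qq').
  - move=> r; split=> [Rr|[r' rr' Rr']].
      by have [//|_ [_ [r' rr' <-] <-] [Rr' _]] := mm _ _ (Up_round r); exists r'.
    by have [//|_ [_ -> <-] [Rr _]] := mm _ _ (Up_up rr').
  - by move=> q r Lq Rr; have [//|_ [_ [_ qr] _] _] := mm _ _ (Cut_disjoint q r).
  - move=> q r qr; have [//|_ [_ [->|->] <-] [h _]] := mm _ _ (Cut_located qr).
      by left.
    by right.
move=> l S; case=> /=.
- by move=> _; exists (L q0 /\ True) => //; exists [:: Lo q0] => //; exists q0.
- by move=> _; exists (R r0 /\ True) => //; exists [:: Up r0] => //; exists r0.
- move=> q q' qq' [Lq' _]; exists (L q /\ True); first by exists [:: Lo q].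
  by split=> //; apply/Lr; exists q'.
- move=> q [/Lr [q' qq' Lq'] _]; exists (L q' /\ True) => //.
  by exists [:: Lo q'] => //; exists q'.
- move=> r r' rr' [Rr' _]; exists (R r /\ True); first by exists [:: Up r].
  by split=> //; apply/Rr; exists r'.
- move=> r [/Rr [r' rr' Rr'] _]; exists (R r' /\ True) => //.
  by exists [:: Up r'] => //; exists r'.
- by move=> q r [Lq [Rr' _]]; exists True => //; exists [::] => //; split=> //; exact: dis.
- move=> q r /loc [h|h] _; [exists (L q /\ True)|exists (R r /\ True)] => //.
    by exists [:: Lo q] => //; left.
  by exists [:: Up r] => //; right.
Qed.

Definition rat_cut (a : rat) (s : cut_sym) : one_space :=
  match s with Lo q => q < a | Up r => a < r end.

Lemma rat_cut_model a : @is_model real_theory one_space (rat_cut a).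
Proof.
apply/real_modelP; split=> /=.
- by split; [exists (a - 1)|exists (a + 1)]; rewrite /= ?ltrBlDr ltrDl ltr01.
- move=> q; split=> [qa|[q' qq' q'a]]; last exact: lt_trans q'a.
  by exists ((q + a) / 2%:R); rewrite /= ?midf_lt.
- move=> r; split=> [ar|[r' r'r ar']]; last exact: lt_trans r'r.
  by exists ((a + r) / 2%:R); rewrite /= ?midf_lt.
- by move=> q r; exact: lt_trans.
- move=> q r qr; case: (ltP q a) => [|aq]; first by left.
  by right; exact: le_lt_trans qr.
Qed.

Lemma one_pos_model : @is_model pos_theory one_space (rat_cut 1).
Proof.
move=> l S [|[-> ->] _]; first exact: rat_cut_model.
by exists (rat_cut 1 (Lo 0) /\ True) => //; exists [:: Lo 0].
Qed.

Lemma one_pos_le1_model : @is_model pos_le1_theory one_space (rat_cut 1).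
Proof.
move=> l S [|[-> ->]]; first exact: one_pos_model.
by case; rewrite /= ltxx.
Qed.

Lemma one_ge1_model : @is_model ge1_theory one_space (rat_cut 1).
Proof.
move=> l S [|[-> ->]]; first exact: rat_cut_model.
by case; rewrite /= ltxx.
Qed.

Definition halves : space := coprod pos_le1 ge1.

Definition one_left : one_space ~> halves :=
  coprod_inl pos_le1 ge1 \oS classify one_pos_le1_model.

Definition one_right : one_space ~> halves :=
  coprod_inr pos_le1 ge1 \oS classify one_ge1_model.

Definition glue : halves ~> pos_reals := copair incl_pos_le1 incl_ge1.

(* Main.v *)
(* Let f : Z -> (0,oo) and let a, b be the opens of Z where f < 1 and f > 1,
   so that a /\ b = 0.  The pullbacks of (0,1], [1,oo) and {1} along f are the
   closed complements of b, a and a \/ b, with frames of opens given by the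
   up-sets of b, a and a \/ b.  Hence the pulled back fork is dual to
   O(Z) -> up(b) x up(a) => up(a \/ b), where w goes to (w \/ b, w \/ a); it is
   an equaliser of frames because a /\ b = 0, a pair (u, v) with
   u \/ a = v \/ b coming from u /\ v alone. *)
From Stdlib Require Import List.
From mathcomp Require Import all_boot all_order all_algebra.
From mathcomp Require Import boolp classical_sets.
Require Import Defs.

Set Implicit Arguments.
Unset Strict Implicit.
Unset Printing Implicit Defensive.

Import Order.TTheory GRing.Theory Num.Theory.
Local Open Scope ring_scope.
Local Open Scope classical_set_scope.

(** * Finite joins, covers and distributivity in a frame *)

Definition opbot (X : frame) : X := opjoin set0.

Definition opor (X : frame) (a b : X) : X := opjoin [set a; b].

Section FrameLattice.
Variable X : frame.
Implicit Types (a b c d : X) (S : set X).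

Lemma opbot_le a : ople (opbot X) a.
Proof. by apply/opjoin_le. Qed.

Lemma ople_bot a : ople a (opbot X) -> a = opbot X.
Proof. by move=> h; apply: ople_anti => //; exact: opbot_le. Qed.

Lemma le_or1 a b : ople a (opor a b).
Proof. by apply: le_join; left. Qed.

Lemma le_or2 a b : ople b (opor a b).
Proof. by apply: le_join; right. Qed.

Lemma or_le a b c : ople a c -> ople b c -> ople (opor a b) c.
Proof. by move=> ac bc; apply/opjoin_le => _ [->|->]. Qed.

Lemma or_absorb a b : ople a b -> opor b a = b.
Proof.
move=> ab; apply: ople_anti; last exact: le_or1.
by apply: or_le => //; exact: ople_refl.
Qed.

Lemma le_meet a b c : ople c a -> ople c b -> ople c (opmeet a b).
Proof. by move=> ca cb; apply/ople_meet. Qed.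

Lemma meet_mono a b c d : ople a c -> ople b d -> ople (opmeet a b) (opmeet c d).
Proof.
move=> ac bd; apply: le_meet.
  exact: ople_trans (meet_le1 _ _) ac.
exact: ople_trans (meet_le2 _ _) bd.
Qed.

Lemma le_cover a c S :
  ople a (opjoin S) -> (forall s, S s -> ople (opmeet a s) c) -> ople a c.
Proof.
move=> aS h; apply: ople_trans (le_meet (ople_refl a) aS) _.
apply: ople_trans (opmeet_join _ _) _.
by apply/opjoin_le => _ [s /h sc <-].
Qed.

Lemma le_cover2 a b c d :
  ople a (opor b c) -> ople (opmeet a b) d -> ople (opmeet a c) d -> ople a d.
Proof. by move=> abc bd cd; apply: le_cover abc _ => _ [->|->]. Qed.

(** By distributivity the left-hand side is [c] joined with the meet of [b] and [a]. This makes the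
    map sending [w] to its joins with [b] and with [a] injective. *)
Lemma or_meet_disjoint a b c :
  opmeet a b = opbot X -> opmeet (opor c b) (opor c a) = c.
Proof.
move=> ab; apply: ople_anti; last by apply: le_meet; exact: le_or1.
apply: (le_cover2 (meet_le1 _ _)); first exact: meet_le2.
apply: (@le_cover2 _ c a); last 1 first.
- apply: (@ople_trans _ _ (opbot X)); last exact: opbot_le.
  rewrite -ab; apply: le_meet; first exact: meet_le2.
  exact: ople_trans (meet_le1 _ _) (meet_le2 _ _).
- exact: ople_trans (meet_le1 _ _) (meet_le2 _ _).
- exact: meet_le2.
Qed.

(** Since [u] lies below the join of [v] and [b], distributivity splits it into a part below [v] and
    a part below [b]. Used twice with the roles exchanged, this shows that a matching pair is
    recovered from its meet. *)
Lemma meet_or_glue a b u v :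
  ople b u -> opor u a = opor v b -> opor (opmeet u v) b = u.
Proof.
move=> bu e; apply: ople_anti.
  by apply: or_le => //; exact: meet_le1.
apply: (@le_cover2 _ v b); first by rewrite -e; exact: le_or1.
  exact: le_or1.
exact: ople_trans (meet_le2 _ _) (le_or2 _ _).
Qed.

Lemma meet_bot a : opmeet a (opbot X) = opbot X.
Proof. by apply: ople_bot; exact: meet_le2. Qed.

Lemma bot_meet a : opmeet (opbot X) a = opbot X.
Proof. by apply: ople_bot; exact: meet_le1. Qed.

Lemma meetC a b : opmeet a b = opmeet b a.
Proof. by apply: ople_anti; exact: le_meetC. Qed.

End FrameLattice.

Section HomLattice.
Variables (A B : frame) (h : frame_hom A B).

Lemma hom_bot : h (opbot A) = opbot B.
Proof. by rewrite fhom_join image_set0. Qed.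

Lemma hom_or a b : h (opor a b) = opor (h a) (h b).
Proof. by rewrite fhom_join image_setU !image_set1. Qed.

End HomLattice.

Lemma coprod_bot (A B : space) : opbot (coprod A B) = (opbot A, opbot B).
Proof. by congr pair; rewrite image_set0. Qed.

(** * Closed subspaces as up-sets *)

(* The closed complement of b has as opens the opens of X containing b. *)
Section Closed.
Variables (X : frame) (b : X).

Definition above : Type := {u : X | ople b u}.

Lemma above_eq (u v : above) : sval u = sval v -> u = v.
Proof.
case: u v => [u bu] [v bv] /= uv; subst v.
by congr exist; exact: Prop_irrelevance.
Qed.

Definition above_or (u : X) : above := exist _ (opor u b) (le_or2 u b).

(** Joining with [b] once more matters for the empty family, whose join has to be the least open
    [b]. *)
Definition closed : space.
Proof.
refine (@Frame above (fun u v => ople (sval u) (sval v))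
  (exist _ _ (ople_top b))
  (fun u v => exist _ _ (le_meet (svalP u) (svalP v)))
  (fun S => above_or (opjoin (sval @` S))) _ _ _ _ _ _ _).
- by move=> u; exact: ople_refl.
- by move=> u v w; exact: ople_trans.
- by move=> u v uv vu; apply: above_eq; exact: ople_anti.
- by move=> u; exact: ople_top.
- by move=> u v w; exact: ople_meet.
- move=> S c /=; split=> [h u Su|h].
    by apply: ople_trans h; apply: ople_trans (le_or1 _ _); apply: le_join; exists u.
  by apply: or_le; [apply/opjoin_le => _ [u Su <-]; exact: h|exact: svalP].
- move=> u S /=; apply: (le_cover2 (meet_le2 _ _)).
    apply: (le_cover (meet_le2 _ _)) => _ [v Sv <-].
    apply: ople_trans (le_or1 _ _); apply: ople_trans (le_join _); last first.
      by exists (exist _ _ (le_meet (svalP u) (svalP v))) => //; exists v.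
    apply: le_meet; last exact: meet_le2.
    by do 2 apply: ople_trans (meet_le1 _ _) _; exact: meet_le1.
  exact: ople_trans (meet_le2 _ _) (le_or2 _ _).
Defined.

Definition closed_incl : closed ~> X.
Proof.
refine (@FrameHom X closed above_or _ _ _).
- by apply: above_eq; apply: ople_anti; [exact: ople_top|exact: le_or1].
- move=> u v; apply: above_eq => /=; apply: ople_anti.
    apply: or_le; last by apply: le_meet; exact: le_or2.
    by apply: meet_mono; exact: le_or1.
  apply: (le_cover2 (meet_le1 _ _)); last exact: ople_trans (meet_le2 _ _) (le_or2 _ _).
  apply: (@le_cover2 _ _ v b).
  + exact: ople_trans (meet_le1 _ _) (meet_le2 _ _).
  + by apply: ople_trans (le_or1 _ _); apply: meet_mono (ople_refl _); exact: meet_le2.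
  + exact: ople_trans (meet_le2 _ _) (le_or2 _ _).
- move=> S; apply: above_eq => /=; apply: ople_anti.
    apply: or_le; last exact: le_or2.
    apply: ople_trans (le_or1 _ _); apply/opjoin_le => u Su.
    apply: ople_trans (le_or1 u b) _; apply: le_join.
    by exists (above_or u) => //; exists u.
  apply: or_le; last exact: le_or2.
  apply/opjoin_le => _ [_ [u Su <-] <-]; apply: or_le; last exact: le_or2.
  by apply: ople_trans (le_or1 _ _); exact: le_join.
Defined.

Lemma closed_bot : opbot closed = above_or (opbot X).
Proof. by apply: above_eq; rewrite /= image_set0. Qed.

Lemma closed_incl_bot (c : X) : ople c b -> closed_incl c = opbot closed.
Proof.
move=> cb; rewrite closed_bot; apply: above_eq => /=; apply: ople_anti.
  by apply: or_le; [exact: ople_trans cb (le_or2 _ _)|exact: le_or2].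
by apply: or_le; [exact: opbot_le|exact: le_or2].
Qed.

Lemma closed_incl_sval (u : closed) : closed_incl (sval u) = u.
Proof. by apply: above_eq; apply: or_absorb; exact: svalP. Qed.

(** Because [h] kills [b], it does not see the extra joinand [b], so its restriction to the up-set
    still preserves joins. *)
Lemma closed_factor (T : space) (h : T ~> X) :
  h b = opbot T -> exists k : T ~> closed, closed_incl \oS k = h.
Proof.
move=> hb.
have hor (u : X) : h (opor u b) = h u.
  by rewrite hom_or hb or_absorb //; exact: opbot_le.
unshelve eexists.
  refine (@FrameHom closed T (fun u => h (sval u)) _ _ _).
  - exact: fhom_top.
  - by move=> u v; exact: fhom_meet.
  - by move=> S; rewrite /= hor fhom_join image_comp.
by apply: frame_homP => u; exact: hor.
Qed.

End Closed.

(** * Subspace inclusions, and coequalisers as equalisers of frames *)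

Section Embeddings.
Variables (C Q : space) (i : C ~> Q).

Definition embedding : Prop := forall y : C, exists x : Q, i x = y.

(** Together with [embedding] and [i a] being bottom, this characterises the closed complement of
    [a] by its universal property, which can be tested on presented spaces through models;
    [embedding] gives uniqueness of [k]. *)
Definition contains_complement (a : Q) : Prop :=
  forall (T : space) (h : T ~> Q), h a = opbot T -> exists k : T ~> C, i \oS k = h.

Lemma embedding_mono (T : space) (h k : T ~> C) :
  embedding -> i \oS h = i \oS k -> h = k.
Proof.
move=> e hk; apply: frame_homP => y; have [x <-] := e y.
exact: (congr1 (fun g : T ~> Q => g x) hk).
Qed.

End Embeddings.

(** On opens [p] identifies [Q] with the equaliser of [u] and [v]. Any competing [h] has its values
    there, and injectivity of [p] reflects the homomorphism laws back to the lift. *)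
Lemma coequaliser_of_equaliser (X Y Q : space) (u v : X ~> Y) (p : Y ~> Q) :
  p \oS u = p \oS v -> injective p ->
  (forall y : Y, u y = v y -> exists x : Q, p x = y) ->
  is_coequaliser u v p.
Proof.
move=> pe inj im; split=> // W h he.
have /choice [k kh] : forall w : W, exists x : Q, p x = h w.
  by move=> w; apply: im; exact: (congr1 (fun g : X ~> W => g w) he).
unshelve eexists.
  refine (@FrameHom W Q k _ _ _).
  - by apply: inj; rewrite kh !fhom_top.
  - by move=> a b; apply: inj; rewrite fhom_meet !kh fhom_meet.
  - move=> S; apply: inj; rewrite kh !fhom_join image_comp; congr opjoin.
    by apply: eq_imagel => w _ /=; rewrite kh.
split=> [|k' k'h]; first by apply: frame_homP => w; exact: kh.
apply: frame_homP => w; apply: (inj) => /=; rewrite kh.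
exact: esym (congr1 (fun g : Y ~> W => g w) k'h).
Qed.

(** * Maps pasted along a clopen partition *)

(* Maps into a coproduct of closed subspaces of Z: those are the maps z into Z
   together with a clopen partition l, r of the domain such that z avoids b on
   l and avoids a on r. *)
Section IntoClosedCoproduct.
Variables (Y Z : space) (z : Y ~> Z) (b a : Z) (l r : Y).
Hypotheses (lr_cover : opor l r = optop Y) (lr_disj : opmeet l r = opbot Y).
Hypotheses (lb : opmeet (z b) l = opbot Y) (ra : opmeet (z a) r = opbot Y).

Definition part_fun (d : coprod (closed b) (closed a)) : Y :=
  opor (opmeet (z (sval d.1)) l) (opmeet (z (sval d.2)) r).

Let bot_le_meet (c d : Y) e : opmeet c d = opbot Y -> ople (opmeet c d) e.
Proof. by move=> ->; exact: opbot_le. Qed.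

Lemma part_fun_l d : opmeet (part_fun d) l = opmeet (z (sval d.1)) l.
Proof.
apply: ople_anti; last first.
  by apply: le_meet; [exact: le_or1|exact: meet_le2].
apply: (@le_cover2 _ _ (opmeet (z (sval d.1)) l) (opmeet (z (sval d.2)) r)).
- exact: meet_le1.
- exact: meet_le2.
- apply: ople_trans (bot_le_meet _ lr_disj); apply: meet_mono; exact: meet_le2.
Qed.

Lemma part_fun_r d : opmeet (part_fun d) r = opmeet (z (sval d.2)) r.
Proof.
apply: ople_anti; last first.
  by apply: le_meet; [exact: le_or2|exact: meet_le2].
apply: (@le_cover2 _ _ (opmeet (z (sval d.1)) l) (opmeet (z (sval d.2)) r)).
- exact: meet_le1.
- apply: ople_trans (bot_le_meet _ lr_disj); rewrite [opmeet l r]meetC.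
  apply: meet_mono; exact: meet_le2.
- exact: meet_le2.
Qed.

Lemma part_le (c d : Y) :
  ople (opmeet c l) d -> ople (opmeet c r) d -> ople c d.
Proof. by apply: le_cover2; rewrite lr_cover; exact: ople_top. Qed.

Lemma part_eq (c d : Y) :
  opmeet c l = opmeet d l -> opmeet c r = opmeet d r -> c = d.
Proof.
move=> hl hr; apply: ople_anti; apply: part_le; rewrite ?hl ?hr; try exact: meet_le1.
  by rewrite -hl; exact: meet_le1.
by rewrite -hr; exact: meet_le1.
Qed.

(** On [e] the map avoids [c], so adding [c] to an open changes nothing there. This absorbs the
    extra joinand in [closed_incl] and in the joins of [closed]. *)
Lemma hom_or_meet c w e : opmeet (z c) e = opbot Y ->
  opmeet (z (opor w c)) e = opmeet (z w) e.
Proof.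
move=> ce; rewrite hom_or; apply: ople_anti.
  apply: (le_cover2 (meet_le1 _ _)).
    by apply: le_meet; [exact: meet_le2|exact: ople_trans (meet_le1 _ _) (meet_le2 _ _)].
  apply: ople_trans (bot_le_meet _ ce); apply: le_meet; first exact: meet_le2.
  exact: ople_trans (meet_le1 _ _) (meet_le2 _ _).
by apply: meet_mono (ople_refl _); exact: le_or1.
Qed.

Lemma part_fun_incl w :
  part_fun (copair (closed_incl b) (closed_incl a) w) = z w.
Proof.
by apply: part_eq; rewrite (part_fun_l, part_fun_r) hom_or_meet.
Qed.

Definition part_map : Y ~> coprod (closed b) (closed a).
Proof.
refine (@FrameHom (coprod (closed b) (closed a)) Y part_fun _ _ _).
(* The top of the coproduct is the image of the top of [Z], so [part_fun_incl] applies. *)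
- by rewrite -(fhom_top z) -part_fun_incl fhom_top.
- have meetr (c d e : Y) : opmeet (opmeet c d) e = opmeet (opmeet c e) (opmeet d e).
    apply: ople_anti.
      by apply: le_meet; apply: meet_mono (ople_refl _); [exact: meet_le1|exact: meet_le2].
    by apply: le_meet; [apply: meet_mono; exact: meet_le1|exact: ople_trans (meet_le1 _ _) (meet_le2 _ _)].
  move=> c d; apply: part_eq.
    by rewrite part_fun_l meetr !part_fun_l /= fhom_meet meetr.
  by rewrite part_fun_r meetr !part_fun_r /= fhom_meet meetr.
- move=> S; apply: ople_anti; last first.
    apply/opjoin_le => _ [d Sd <-]; apply: part_le; rewrite (part_fun_l, part_fun_r).
      apply: ople_trans (le_or1 _ _); apply: meet_mono (ople_refl _); apply: hom_mono.
      by apply: ople_trans (le_or1 _ _); apply: le_join; exists d.1 => //; exists d.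
    apply: ople_trans (le_or2 _ _); apply: meet_mono (ople_refl _); apply: hom_mono.
    by apply: ople_trans (le_or1 _ _); apply: le_join; exists d.2 => //; exists d.
  apply: or_le; rewrite hom_or_meet // fhom_join;
    apply: (le_cover (meet_le1 _ _)) => _ [_ [_ [d Sd <-] <-] <-];
    apply: ople_trans (le_join _); try (by exists d).
    apply: ople_trans (le_or1 _ _); apply: le_meet; first exact: meet_le2.
    exact: ople_trans (meet_le1 _ _) (meet_le2 _ _).
  apply: ople_trans (le_or2 _ _); apply: le_meet; first exact: meet_le2.
  exact: ople_trans (meet_le1 _ _) (meet_le2 _ _).
Defined.

End IntoClosedCoproduct.

(** * Gluing two closed subspaces whose open complements are disjoint *)

Section ClosedGluing.
Variables (X C D Q : space) (i : C ~> Q) (j : D ~> Q) (x : X ~> C) (y : X ~> D).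
Variables (a b : Q).
Hypotheses (ab : opmeet a b = opbot Q) (xy : i \oS x = j \oS y).
Hypotheses (ie : embedding i) (ib : i b = opbot C) (ic : contains_complement i b).
Hypotheses (je : embedding j) (ja : j a = opbot D) (jc : contains_complement j a).
Hypothesis xc : contains_complement (i \oS x) (opor a b).

Let u := coprod_inl C D \oS x.
Let v := coprod_inr C D \oS y.
Let p := copair i j.

(** The given pullbacks are compared with the concrete closed models [E] and [T] over [Z] through
    maps [e : E ~> X'] and [t : T ~> Y']. It suffices that [t] is injective on opens: the equaliser
    condition is pushed along [e] and solved in [T]. *)
Lemma closed_gluing : pullback_stable_coequaliser u v p.
Proof.
move=> Z f X' Y' xX xZ yY yZ u' v' pbX pbY uX uZ vX vZ.
pose a' : Z := f a; pose b' : Z := f b.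
have ab' : opmeet a' b' = opbot Z by rewrite -fhom_meet ab hom_bot.
pose T := coprod (closed b') (closed a').
pose c : T ~> Z := copair (closed_incl b') (closed_incl a').
(* [gC] and [gD] restrict [f] to the two closed pieces of [Z]; they make [T] a cone over the
   pullback square of [Y'], whence [t]. *)
have [gC gCE] : exists k, i \oS k = f \oS closed_incl b'.
  by apply: ic; apply: closed_incl_bot; exact: ople_refl.
have [gD gDE] : exists k, j \oS k = f \oS closed_incl a'.
  by apply: jc; apply: closed_incl_bot; exact: ople_refl.
pose g : T ~> coprod C D := copair (coprod_inl C D \oS gC) (coprod_inr C D \oS gD).
have gE : p \oS g = f \oS c.
  apply: frame_homP => q; congr pair.
    exact: (congr1 (fun h : closed b' ~> Q => h q) gCE).
  exact: (congr1 (fun h : closed a' ~> Q => h q) gDE).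
have [t [[tY tZ] _]] := pbY.2 _ _ _ gE.
have tZE w : t (yZ w) = c w := congr1 (fun h : T ~> Z => h w) tZ.
have tYE e : t (yY e) = g e := congr1 (fun h : T ~> coprod C D => h e) tY.
have pbE q : yY (p q) = yZ (f q) := congr1 (fun h : Y' ~> Q => h q) pbY.1.
have cI : injective c.
  move=> w w' ww'; rewrite -(or_meet_disjoint w ab') -(or_meet_disjoint w' ab').
  by congr opmeet; [move/(congr1 (fun d => sval d.1)): ww'|move/(congr1 (fun d => sval d.2)): ww'].
have yI : injective yZ by move=> w w' ww'; apply: cI; rewrite -!tZE ww'.
(* The inverse images of the two summands form a clopen partition of [Y']. Over [l] the map to [Q]
   passes through [C], where [b] vanishes; over [r] it passes through [D], where [a] vanishes. *)
pose l := yY (optop C, opbot D); pose r := yY (opbot C, optop D).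
have lr1 : opor l r = optop Y'.
  rewrite -hom_or -(fhom_top yY); congr (yY _); apply: ople_anti; first exact: ople_top.
  by split; apply: le_join; [exists (optop C, opbot D); first left
                            |exists (opbot C, optop D); first right].
have lr0 : opmeet l r = opbot Y'.
  by rewrite -fhom_meet -(hom_bot yY) coprod_bot /= meet_bot bot_meet.
have lb : opmeet (yZ b') l = opbot Y'.
  by rewrite -pbE -fhom_meet -(hom_bot yY) coprod_bot /= ib meet_bot bot_meet.
have ra : opmeet (yZ a') r = opbot Y'.
  by rewrite -pbE -fhom_meet -(hom_bot yY) coprod_bot /= ja meet_bot bot_meet.
pose s : Y' ~> T := part_map lr1 lr0 lb ra.
have sZ : c \oS s = yZ by apply: frame_homP => w; exact: part_fun_incl.
have sY : g \oS s = yY.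
  apply: frame_homP => -[e1 e2] /=.
  (* Opens of [C] and [D] come from opens of [Q], on which the square [pbE] expresses [yY] through
     [f]. *)
  have [q1 q1E] := ie e1; have [q2 q2E] := je e2.
  have g1 : gC e1 = closed_incl b' (f q1).
    by rewrite -q1E; exact: (congr1 (fun h : closed b' ~> Q => h q1) gCE).
  have g2 : gD e2 = closed_incl a' (f q2).
    by rewrite -q2E; exact: (congr1 (fun h : closed a' ~> Q => h q2) gDE).
  apply: (part_eq lr1); rewrite ?part_fun_l // ?part_fun_r //=.
    by rewrite g1 /= hom_or_meet // -pbE /l -!fhom_meet /= q1E !meet_bot.
  by rewrite g2 /= hom_or_meet // -pbE /r -!fhom_meet /= q2E !meet_bot.
have pbY_ext (S : space) (k k' : S ~> Y') :
    yY \oS k = yY \oS k' -> yZ \oS k = yZ \oS k' -> k = k'.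
  move=> kY kZ.
  have kE : p \oS (yY \oS k) = f \oS (yZ \oS k).
    by apply: frame_homP => q /=; rewrite pbE.
  have [k0 [_ k0U]] := pbY.2 _ _ _ kE.
  by rewrite -(k0U k) // -(k0U k').
(* Read on opens, this makes [s] a left inverse of [t]. *)
have ts : t \oS s = sid Y'.
  apply: pbY_ext; apply: frame_homP => e /=.
    by rewrite tYE; exact: (congr1 (fun h : Y' ~> coprod C D => h e) sY).
  by rewrite tZE; exact: (congr1 (fun h : Y' ~> Z => h e) sZ).
have tI : injective t.
  move=> d d' dd'; have E e : s (t e) = e := congr1 (fun h : Y' ~> Y' => h e) ts.
  by rewrite -(E d) dd' E.
(* [E] is the intersection of the two closed pieces of [Z]; by [xc], the restriction of [f] to it
   factors through [X]. *)
pose ab1 := opor a' b'; pose E := closed ab1; pose cE := closed_incl ab1.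
have [o oE] : exists k, (i \oS x) \oS k = f \oS cE.
  by apply: xc; rewrite /= hom_or; apply: closed_incl_bot; exact: ople_refl.
have puE : p \oS u = i \oS x by exact: frame_homP.
have [e [[eX eZ] _]] : exists! e, xX \oS e = o /\ xZ \oS e = cE.
  by apply: pbX.2; rewrite puE.
have [nl nlE] : exists k : E ~> closed b', closed_incl b' \oS k = cE.
  by apply: closed_factor; apply: closed_incl_bot; exact: le_or2.
have [nr nrE] : exists k : E ~> closed a', closed_incl a' \oS k = cE.
  by apply: closed_factor; apply: closed_incl_bot; exact: le_or1.
have eXE w : e (xX w) = o w := congr1 (fun h : E ~> X => h w) eX.
have eZE w : e (xZ w) = cE w := congr1 (fun h : E ~> Z => h w) eZ.
have nlEE w : nl (closed_incl b' w) = cE w := congr1 (fun h : E ~> Z => h w) nlE.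
have nrEE w : nr (closed_incl a' w) = cE w := congr1 (fun h : E ~> Z => h w) nrE.
have xo : x \oS o = gC \oS nl.
  apply: (embedding_mono ie); apply: frame_homP => q.
  rewrite -[RHS]/((i \oS gC \oS nl) q) gCE /= nlEE.
  exact: (congr1 (fun h : E ~> Q => h q) oE).
have yo : y \oS o = gD \oS nr.
  apply: (embedding_mono je); apply: frame_homP => q.
  rewrite -[RHS]/((j \oS gD \oS nr) q) gDE -[LHS]/((j \oS y \oS o) q) -xy /= nrEE.
  exact: (congr1 (fun h : E ~> Q => h q) oE).
(* Along [e] and [t], the maps [u'] and [v'] correspond to the inclusions of [E] in the left and in
   the right piece of [T]. *)
have uE : u' \oS e = t \oS (coprod_inl _ _ \oS nl).
  apply: pbY_ext; apply: frame_homP => d.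
    rewrite -[LHS]/((yY \oS u' \oS e) d) uX /= eXE tYE /=.
    exact: (congr1 (fun h : E ~> C => h d.1) xo).
  by rewrite -[LHS]/((yZ \oS u' \oS e) d) uZ /= eZE tZE /= nlEE.
have vE : v' \oS e = t \oS (coprod_inr _ _ \oS nr).
  apply: pbY_ext; apply: frame_homP => d.
    rewrite -[LHS]/((yY \oS v' \oS e) d) vX /= eXE tYE /=.
    exact: (congr1 (fun h : E ~> D => h d.2) yo).
  by rewrite -[LHS]/((yZ \oS v' \oS e) d) vZ /= eZE tZE /= nrEE.
apply: coequaliser_of_equaliser => //; first by rewrite uZ vZ.
move=> d uvd; exists (opmeet (sval (t d).1) (sval (t d).2)); apply: tI; rewrite tZE.
case td : (t d) => [d1 d2] /=.
have b1 := svalP d1; have a2 := svalP d2.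
have glued : cE (sval d1) = cE (sval d2).
  rewrite -nlEE -nrEE !closed_incl_sval.
  have -> : nl d1 = e (u' d).
    rewrite -[RHS](congr1 (fun h : E ~> Y' => h d) (esym uE)) /=.
    by rewrite td.
  have -> : nr d2 = e (v' d).
    rewrite -[RHS](congr1 (fun h : E ~> Y' => h d) (esym vE)) /=.
    by rewrite td.
  by rewrite uvd.
(* As [d1] contains [b'] and [d2] contains [a'], joining with [ab1] amounts to joining [d1] with
   [a'] and [d2] with [b']. *)
have {glued} d12 : opor (sval d1) a' = opor (sval d2) b'.
  move/(congr1 sval): glued => /= glued; apply: ople_anti.
    apply: ople_trans (_ : ople _ (opor (sval d1) ab1)) _.
      by apply: or_le; [exact: le_or1|exact: ople_trans (le_or1 _ _) (le_or2 _ _)].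
    rewrite glued; apply: or_le; first exact: le_or1.
    by apply: or_le; [exact: ople_trans a2 (le_or1 _ _)|exact: le_or2].
  apply: ople_trans (_ : ople _ (opor (sval d2) ab1)) _.
    by apply: or_le; [exact: le_or1|exact: ople_trans (le_or2 _ _) (le_or2 _ _)].
  rewrite -glued; apply: or_le; first exact: le_or1.
  by apply: or_le; [exact: le_or2|exact: ople_trans b1 (le_or1 _ _)].
congr pair; apply: above_eq => /=; first exact: meet_or_glue d12.
by rewrite meetC; exact: meet_or_glue (esym d12).
Qed.

End ClosedGluing.

(** Pull back along the identity of [Q]. *)
Lemma stable_coequaliser (X Y Q : space) (u v : X ~> Y) (p : Y ~> Q) :
  p \oS u = p \oS v -> pullback_stable_coequaliser u v p -> is_coequaliser u v p.
Proof.
move=> uv st.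
have pb (A B : space) (h : A ~> B) : is_pullback (sid A) h h (sid B).
  split=> [|T k k' kk']; first exact: frame_homP.
  exists k; split=> [|k0 [<- _]]; last exact: frame_homP.
  split; first exact: frame_homP.
  by rewrite kk'; exact: frame_homP.
by apply: (st Q (sid Q) X Y (sid X) (p \oS u) (sid Y)) => //; exact: frame_homP.
Qed.

(** * Models under homomorphisms, embeddings of presented spaces, maps to the point *)

Lemma model_hom (T : theory) (A B : frame) (h : frame_hom A B) (m : thsym T -> A) :
  is_model m -> is_model (fun s => h (m s)).
Proof.
move=> mm l S ax; rewrite -hom_conj; apply: ople_trans (hom_mono h (mm _ _ ax)) _.
rewrite fhom_join image_comp; apply: join_mono => _ [k Sk <-] /=.
by exists (h (fconj m k)); [exists k => //; rewrite hom_conj|exact: ople_refl].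
Qed.

Lemma model_add_axiom (T : theory) l S (A : frame) (m : thsym T -> A) :
  is_model m -> ople (fconj m l) (opjoin [set fconj m k | k in S]) ->
  @is_model (@add_axiom T l S) A m.
Proof. by move=> mm h k R [/mm|[-> ->]]. Qed.

(** Every open [B] is the join of the basic opens below it, and each of these is an interpreted
    conjunction. The preimage taken is the set of all conjunctions interpreted below [B], saturated
    because [m] is a model. *)
Lemma classify_embedding (T T' : theory) (m : thsym T -> space_of T')
    (mm : is_model m) :
  (forall k, exists l, fconj m l = sat_of k) -> embedding (classify mm).
Proof.
move=> gen B; exists (exist _ _ (model_saturated B mm)).
apply: (@ople_anti (space_of T')).
  by apply/opjoin_le => _ [l lB <-].
move=> k /sat_of_min kB; have [l lk] := gen k.
apply/sat_of_min; apply: le_join; exists l => //=.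
by rewrite lk.
Qed.

(** The inverse image of a truth value is the join of a subsingleton, so no case distinction on [P]
    enters. *)
Definition to_one (S : space) : S ~> one_space.
Proof.
refine (@FrameHom one_space S (fun P => opjoin [set c | c = optop S /\ P]) _ _ _).
- by apply: ople_anti; [exact: ople_top|exact: le_join].
- move=> P P'; apply: ople_anti.
    by apply: le_meet; apply/opjoin_le => _ [-> [p p']]; apply: le_join.
  apply: (le_cover (meet_le1 _ _)) => _ [-> p].
  apply: ople_trans (meet_le1 _ _) _; apply: (le_cover (meet_le2 _ _)) => _ [-> p'].
  by apply: ople_trans (meet_le2 _ _) _; apply: le_join.
- move=> F; apply: ople_anti; apply/opjoin_le.
    move=> _ [-> [P FP p]]; apply: ople_trans (_ : ople _ (opjoin [set c | c = optop S /\ P])) _.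
      exact: le_join.
    by apply: le_join; exists P.
  by move=> _ [P FP <-]; apply/opjoin_le => _ [-> p]; apply: le_join; split=> //; exists P.
Defined.

(** * The half-lines at 1 as closed subspaces of the positive reals *)

Section HalfLines.

Let below1 : pos_reals := @generic pos_theory (Up 1).
Let above1 : pos_reals := @generic pos_theory (Lo 1).

Lemma below1_above1 : opmeet below1 above1 = opbot pos_reals.
Proof.
apply: ople_bot; apply: ople_trans (le_meetC _ _) _.
apply: (@ople_trans _ _ (fconj (@generic pos_theory) [:: Lo 1; Up 1])).
  by apply: le_conj => c [<-|[<-|[]]]; [exact: meet_le1|exact: meet_le2].
apply: ople_trans (@generic_model pos_theory _ _ (or_introl (Cut_disjoint 1 1))) _.
by apply/opjoin_le => c [k [_ lt11] _]; rewrite ltxx in lt11.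
Qed.

Lemma added_falsity (T : theory) (g : thsym T) :
  @generic (@add_axiom T [:: g] set0) g = opbot _.
Proof.
apply: ople_bot; have := @generic_model (@add_axiom T [:: g] set0) [:: g] set0.
by rewrite image_set0 conj1; apply; right.
Qed.

(** With [added_falsity], this is why adding the axiom that [g] is false presents the closed
    complement of the open [generic g]. *)
Lemma falsity_model (T : theory) (A : frame) (m : thsym T -> A) g :
  is_model m -> m g = opbot A -> @is_model (@add_axiom T [:: g] set0) A m.
Proof.
by move=> mm mg; apply: model_add_axiom => //; rewrite conj1 mg; exact: opbot_le.
Qed.

Lemma pos_model_real (A : frame) (m : cut_sym -> A) :
  @is_model pos_theory A m -> @is_model real_theory A m.
Proof. by move=> mm l S ax; apply: mm; left. Qed.

Lemma scompE (X Y Z : space) (g : Y ~> Z) (f : X ~> Y) (c : Z) :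
  (g \oS f) c = f (g c).
Proof. by []. Qed.

Lemma incl_pos_le1_generic s :
  incl_pos_le1 (@generic pos_theory s) = @generic pos_le1_theory s.
Proof. exact: (@classify_generic pos_theory). Qed.

Lemma incl_ge1_generic s :
  incl_ge1 (@generic pos_theory s) = @generic ge1_theory s.
Proof. exact: (@classify_generic pos_theory). Qed.

Lemma incl_pos_le1_embedding : embedding incl_pos_le1.
Proof. by apply: classify_embedding => k; exists k; exact: (@conj_generic pos_le1_theory). Qed.

Lemma incl_ge1_embedding : embedding incl_ge1.
Proof. by apply: classify_embedding => k; exists k; exact: (@conj_generic ge1_theory). Qed.

Lemma incl_pos_le1_complement : contains_complement incl_pos_le1 above1.
Proof.
move=> T h h1.
have mm := falsity_model (model_hom h (@generic_model pos_theory)) h1.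
exists (classify mm); apply: (@classify_unique pos_theory) => s.
by rewrite scompE incl_pos_le1_generic classify_generic.
Qed.

Lemma incl_ge1_complement : contains_complement incl_ge1 below1.
Proof.
move=> T h h1.
(* [ge1_theory] extends the theory of the reals, so the axiom [0 < x] is forgotten here;
   [ge1_pos_model] derives it again for [incl_ge1]. *)
have mr := pos_model_real (model_hom h (@generic_model pos_theory)).
have mm := @falsity_model real_theory _ _ (Up 1) mr h1.
exists (classify mm); apply: (@classify_unique pos_theory) => s.
by rewrite scompE incl_ge1_generic classify_generic.
Qed.

Lemma one_glued :
  incl_pos_le1 \oS classify one_pos_le1_model = incl_ge1 \oS classify one_ge1_model.
Proof.
apply: (@classify_unique pos_theory) => s.
by rewrite !scompE incl_pos_le1_generic incl_ge1_generic !classify_generic.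
Qed.

(** If [x < 1] and [1 < x] are both false, locatedness forces [q < x] for each [q < 1] and [x < r]
    for each [r > 1], while monotonicity makes all other symbols false. The generalised point is
    then the rational cut at 1, pulled back from the one-point space. *)
Lemma one_complement :
  contains_complement (incl_pos_le1 \oS classify one_pos_le1_model) (opor below1 above1).
Proof.
move=> T h h1; exists (to_one T); apply: (@classify_unique pos_theory) => s.
pose m c := h (@generic pos_theory c).
have mm : @is_model real_theory T m.
  exact: pos_model_real (model_hom h (@generic_model pos_theory)).
have up1 : m (Up 1) = opbot T.
  by apply: ople_bot; rewrite -h1; apply: hom_mono; exact: le_or1.
have lo1 : m (Lo 1) = opbot T.
  by apply: ople_bot; rewrite -h1; apply: hom_mono; exact: le_or2.
have located q r : q < r -> opor (m (Lo q)) (m (Up r)) = optop T.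
  move=> qr; apply: ople_anti; first exact: ople_top.
  apply: ople_trans (mm _ _ (Cut_located qr)) _.
  apply/opjoin_le => _ [_ [->|->] <-]; rewrite conj1; first exact: le_or1.
  exact: le_or2.
have step c d : cut_axiom [:: c] [set [:: d]] -> ople (m c) (m d).
  by move=> /mm; rewrite conj1 seq1_join.
have to1 (P : Prop) : P -> to_one T P = optop T.
  by move=> p; apply: ople_anti; [exact: ople_top|exact: le_join].
have to0 (P : Prop) : ~ P -> to_one T P = opbot T.
  by move=> np; apply: ople_bot; apply/opjoin_le => c [_ /np].
have -> : ((incl_pos_le1 \oS classify one_pos_le1_model) \oS to_one T) (generic s)
    = to_one T (rat_cut 1 s).
  by rewrite !scompE incl_pos_le1_generic classify_generic.
rewrite -[RHS]/(m s); case: s => [q|r].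
- case: (ltP q 1) => q1.
    by rewrite to1 // -(located _ _ q1) up1 or_absorb //; exact: opbot_le.
  rewrite to0; last by rewrite /= ltNge q1.
  apply: esym; apply: ople_bot; rewrite -lo1.
  move: q1; rewrite le_eqVlt => /predU1P[<-|q1]; first exact: ople_refl.
  by apply: step; exact: Lo_down.
- case: (ltP 1 r) => r1.
    rewrite to1 // -(located _ _ r1) lo1; apply: ople_anti; last exact: le_or2.
    by apply: or_le; [exact: opbot_le|exact: ople_refl].
  rewrite to0; last by rewrite /= ltNge r1.
  apply: esym; apply: ople_bot; rewrite -up1.
  move: r1; rewrite le_eqVlt => /predU1P[->|r1]; first exact: ople_refl.
  by apply: step; exact: Up_up.
Qed.

(** This is [closed_gluing] with [below1] for [a] and [above1] for [b]. *)
Lemma glue_stable : pullback_stable_coequaliser one_left one_right glue.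
Proof.
apply: (closed_gluing below1_above1 one_glued incl_pos_le1_embedding _
  incl_pos_le1_complement incl_ge1_embedding _ incl_ge1_complement one_complement).
  by rewrite incl_pos_le1_generic; exact: (@added_falsity pos_theory).
by rewrite incl_ge1_generic; exact: (@added_falsity real_theory).
Qed.

End HalfLines.

Theorem proposition1p37 :
  is_coequaliser one_left one_right glue /\
  pullback_stable_coequaliser one_left one_right glue.
Proof.
split; last exact: glue_stable.
apply: stable_coequaliser glue_stable; apply: frame_homP => q.
exact: (congr1 (fun h : one_space ~> pos_reals => h q) one_glued).
Qed.
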